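(* Let $P=K[X]$ be endowed with $\sigma$ and a weight function $\mathrm{w}$ as in the context, and let $S=P[s;\sigma]$. Let $I\subsetneq P$ be a $\mathrm{w}$-graded $\Sigma$-invariant ideal, let $I^S\subset S$ be its skew analogue, and let $I^{SP}=\pi(I^S)$. Then $I^{SP}=I$. That is, $I\mapsto I^S$ is a bijective correspondence between all $\mathrm{w}$-graded $\Sigma$-invariant ideals of $P$ different from $P$ and their skew analogues in $S$.
   Context: $K$ is a field, $X=\{x_0,x_1,\ldots\}$ a countable set of variables, $P=K[X]$ the commutative polynomial ring, $\mathrm{Mon}(P)$ its set of monomials (including 1). $\sigma:P\to P$ is an injective $K$-algebra endomorphism of infinite order mapping monomials to monomials, with $\gcd(\sigma(x_i),\sigma(x_j))=1$ for $i\ne j$, and there is a monomial ordering $\prec$ of $P$ (a multiplicatively compatible total well-ordering of $\mathrm{Mon}(P)$) such that $m\prec n$ implies $\sigma(m)\prec\sigma(n)$. $S=P[s;\sigma]$ is the free left $P$-module with basis $\Sigma=\{s^i\}_{i\ge0}$ and multiplication determined by $sf=\sigma(f)s$; it is graded by $S_i=Ps^i$. $\Sigma$ acts on $P$ by $s^i\cdot f=\sigma^i(f)$; an ideal $I\subset P$ is $\Sigma$-invariant if $\sigma(I)\subset I$. $\pi:S\to P$ is the $P$-linear map with $s^i\mapsto1$ for all $i$ (it is a homomorphism of left $S$-modules). Weights: $\hat{\mathbb{N}}=\{-\infty\}\cup\mathbb{N}$, with $\max(-\infty,x)=x$ and $-\infty+x=-\infty$. A weight function is a map $\mathrm{w}:\mathrm{Mon}(P)\to\hat{\mathbb{N}}$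 with $\mathrm{w}(1)=-\infty$, $\mathrm{w}(x_i)\in\mathbb{N}$ for every variable, $\mathrm{w}(mn)=\max(\mathrm{w}(m),\mathrm{w}(n))$, and $\mathrm{w}(\sigma(x_i))=1+\mathrm{w}(x_i)$. $P_i$ is the $K$-span of the monomials of weight $i$, so $P=\bigoplus_{i\in\hat{\mathbb{N}}}P_i$ and $P_{-\infty}=K$. An ideal $I$ is $\mathrm{w}$-graded if $I=\sum_i I_i$ with $I_i=I\cap P_i$. For a $\mathrm{w}$-graded $\Sigma$-invariant ideal $I\subsetneq P$, its skew analogue $I^S$ is the two-sided ideal of $S$ generated by $\{fs^i\mid f\in I_i,\ i\ge0\}$. *)

(* Defs.v *)
From HB Require Import structures.
From mathcomp Require Import all_boot all_order all_algebra.
From mathcomp Require Import finmap.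
From mathcomp Require Import boolp classical_sets functions.
From mathcomp Require Import monalg.

Set Implicit Arguments.
Unset Strict Implicit.
Unset Printing Implicit Defensive.

Import GRing.Theory.

Local Open Scope ring_scope.
Local Open Scope classical_set_scope.

Section Ideals.
Variable R : nzRingType.

Definition is_ideal (I : set R) : Prop :=
  [/\ I 0,
      forall x y, I x -> I y -> I (x + y),
      forall a x, I x -> I (a * x)
    & forall a x, I x -> I (x * a)].

Definition ideal_gen (G : set R) : set R := smallest is_ideal G.

End Ideals.

(* Elements are left polynomials \sum_i f_i s^i, stored as the sequence of
   their left coefficients; only the product differs from {poly R}. *)
Definition skewpoly (R : nzRingType) (sigma : {rmorphism R -> R}) : Type :=
  {poly R}.

Section SkewPoly.
Variables (R : nzRingType) (sigma : {rmorphism R -> R}).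
Local Notation S := (skewpoly sigma).
Local Notation sg i := (iter i sigma).
Implicit Types (i j k : nat) (x y : R).

HB.instance Definition _ := GRing.Lmodule.copy S {poly R}.

Definition skew_mul (p q : {poly R}) : {poly R} :=
  \poly_(i < (size p + size q).-1)
     \sum_(j < i.+1) p`_j * sg j q`_(i - j).

Lemma sg0 i : sg i 0 = 0.
Proof. by elim: i => //= i ->; rewrite rmorph0. Qed.
Lemma sg1 i : sg i 1 = 1.
Proof. by elim: i => //= i ->; rewrite rmorph1. Qed.
Lemma sgD i x y : sg i (x + y) = sg i x + sg i y.
Proof. by elim: i => //= i ->; rewrite rmorphD. Qed.
Lemma sgM i x y : sg i (x * y) = sg i x * sg i y.
Proof. by elim: i => //= i ->; rewrite rmorphM. Qed.
Lemma sg_sum i n (F : 'I_n -> R) :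
  sg i (\sum_(j < n) F j) = \sum_(j < n) sg i (F j).
Proof. exact: (big_morph (sg i) (sgD i) (sg0 i)). Qed.

Lemma coef_skew_mul (p q : {poly R}) i :
  (skew_mul p q)`_i = \sum_(j < i.+1) p`_j * sg j q`_(i - j).
Proof.
rewrite coef_poly; case: ltnP => // le_pq_i; rewrite big1 // => j _.
have [lq_pq_i|gt_pq_i] := leqP (size p) j; first by rewrite nth_default ?mul0r.
rewrite [q`_ _]nth_default ?sg0 ?mulr0 // -(leq_add2r j).
rewrite subnK; last by rewrite -ltnS.
move: le_pq_i; case: (size p) gt_pq_i => // n; rewrite ltnS addSn /= => jn.
by apply: leq_trans; rewrite addnC leq_add2r.
Qed.

Lemma skew_mulA : associative skew_mul.
Proof.
move=> p q r; apply/polyP => i; rewrite !coef_skew_mul.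
transitivity (\sum_(j < i.+1) \sum_(k < i.+1 | (j + k <= i)%N)
    p`_j * sg j q`_k * sg (j + k) r`_(i - (j + k))).
  apply: eq_bigr => j _; rewrite coef_skew_mul sg_sum big_distrr /=.
  have leji : ((i - j).+1 <= i.+1)%N by rewrite ltnS leq_subr.
  rewrite (big_ord_widen _ (fun k : nat =>
    p`_j * sg j (q`_k * sg k r`_(i - j - k))) leji).
  apply: eq_big => [k|k _].
    by rewrite ltnS -(leq_add2l j) subnKC // -ltnS.
  by rewrite sgM mulrA -iterD subnDA.
rewrite (exchange_big_dep xpredT) //=.
transitivity (\sum_(l < i.+1) \sum_(j < i.+1 | (j <= l)%N)
    p`_j * sg j q`_(l - j) * sg l r`_(i - l)); last first.
  apply: eq_bigr => l _; rewrite coef_skew_mul big_distrl /=.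
  have lt_li : (l.+1 <= i.+1)%N by [].
  by rewrite (big_ord_widen _ (fun j : nat =>
    p`_j * sg j q`_(l - j) * sg l r`_(i - l)) lt_li).
rewrite [RHS](exchange_big_dep xpredT) //=.
rewrite (exchange_big_dep xpredT) //=; apply: eq_bigr => j _.
have ltB (l : 'I_i.+1) : (l - j < i.+1)%N.
  by rewrite ltnS (leq_trans (leq_subr _ _)) // -ltnS.
rewrite (reindex_onto (fun l : 'I_i.+1 => inord (l - j) : 'I_i.+1)
                      (fun k : 'I_i.+1 => inord (j + k) : 'I_i.+1)) /=; last first.
  by move=> k h; apply: ord_inj; rewrite inordK ?inordK ?ltnS ?addKn // -ltnS.
apply: eq_big => [l|l /andP[]].
  rewrite (inordK (ltB l)); apply/andP/idP => [[h /eqP <-]|h].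
    by rewrite inordK ?leq_addr.
  by rewrite subnKC // -ltnS ltn_ord inord_val.
rewrite (inordK (ltB l)) => h /eqP e.
have jl : (j <= l)%N by rewrite -e inordK ?leq_addr.
by rewrite subnKC.
Qed.

Lemma skew_mul1l : left_id 1 skew_mul.
Proof.
move=> p; apply/polyP=> i; rewrite coef_skew_mul big_ord_recl subn0 /=.
rewrite coef1 mul1r big1 ?addr0 // => j _.
by rewrite coef1 mul0r.
Qed.

Lemma skew_mul1r : right_id 1 skew_mul.
Proof.
move=> p; apply/polyP=> i; rewrite coef_skew_mul big_ord_recr /= subnn coef1 /=.
rewrite sg1 mulr1 big1 ?add0r // => j _.
by rewrite coef1 subn_eq0 leqNgt ltn_ord sg0 mulr0.
Qed.

Lemma skew_mulDl : left_distributive skew_mul +%R.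
Proof.
move=> p q r; apply/polyP=> i; rewrite coefD !coef_skew_mul -big_split /=.
by apply: eq_bigr => j _; rewrite coefD mulrDl.
Qed.

Lemma skew_mulDr : right_distributive skew_mul +%R.
Proof.
move=> p q r; apply/polyP=> i; rewrite coefD !coef_skew_mul -big_split /=.
by apply: eq_bigr => j _; rewrite coefD sgD mulrDr.
Qed.

HB.instance Definition _ := GRing.Zmodule_isNzRing.Build S
  skew_mulA skew_mul1l skew_mul1r skew_mulDl skew_mulDr (oner_neq0 {poly R}).

Definition skews : S := ('X : {poly R}).

Definition skewpi (F : S) : R :=
  \sum_(i < size (F : {poly R})) (F : {poly R})`_i.

Lemma skew_scalerAl (a : R) (p q : {poly R}) :
  a *: skew_mul p q = skew_mul (a *: p) q.
Proof.
apply/polyP=> i; rewrite coefZ !coef_skew_mul big_distrr /=.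
by apply: eq_bigr => j _; rewrite coefZ mulrA.
Qed.

HB.instance Definition _ := GRing.Lmodule_isLalgebra.Build R S skew_scalerAl.

Lemma skew_mulMX (F : {poly R}) i : skew_mul 'X^i F = 'X^i * map_poly (sg i) F.
Proof.
apply/polyP=> k; rewrite coef_skew_mul coefXnM.
case: ltnP => [lt_ki|le_ik].
  rewrite big1 // => j _; rewrite coefXn.
  by rewrite ltn_eqF ?mul0r // (leq_ltn_trans _ lt_ki) // -ltnS.
rewrite coef_map_id0 ?sg0 // (bigD1 (Ordinal (le_ik : (i < k.+1)%N))) //=.
rewrite coefXn eqxx mul1r big1 ?addr0 // => j ne_ji.
rewrite coefXn; case: eqP => [e|]; last by rewrite mul0r.
by case/eqP: ne_ji; apply: val_inj.
Qed.

Lemma skewsX i : skews ^+ i = ('X^i : {poly R}) :> S.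
Proof.
elim: i => // i IH; rewrite exprSr IH.
change (skew_mul 'X^i 'X = 'X^(i.+1) :> {poly R}).
rewrite skew_mulMX exprSr; congr (_ * _).
apply/polyP=> k; rewrite coef_map_id0 ?sg0 // coefX.
by case: eqP; rewrite ?sg0 ?sg1.
Qed.

Lemma skewsM (f : R) : skews * f%:A = sigma f *: skews.
Proof.
change (skew_mul 'X (f *: 1) = sigma f *: 'X :> {poly R}).
apply/polyP=> k; rewrite -['X]expr1 skew_mulMX coefXnM coefZ coefX.
case: k => [|k] /=; first by rewrite mulr0.
rewrite subSS subn0 coef_map_id0 ?sg0 // coefZ coef1.
by case: k => [|k] /=; rewrite ?mulr1 // !mulr0 rmorph0.
Qed.

Lemma skewpolyE (F : S) :
  F = \sum_(i < size (F : {poly R})) (F : {poly R})`_i *: skews ^+ i.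
Proof.
rewrite -[LHS](@coefK R F) poly_def.
by apply: eq_bigr => i _; rewrite skewsX.
Qed.

End SkewPoly.

Arguments skewpi {R} sigma F.

Notation Mon := {cmonom nat}.

(* The polynomial ring K[x_0, x_1, ...] *)
Notation Pol K := {malg K[{cmonom nat}]}.

Section Polynomials.
Variable K : fieldType.
Local Notation P := (Pol K).

Definition monP (m : Mon) : P := << m >>.
Definition varM (i : nat) : Mon := ucm i.

Definition divides (d f : P) : Prop := exists q, f = q * d.

(* gcd(f, g) = 1 *)
Definition gcd_one (f g : P) : Prop :=
  forall d, divides d f -> divides d g -> divides d 1.

Definition monomial_order (lt : Mon -> Mon -> Prop) : Prop :=
  [/\ forall m, ~ lt m m,
      forall m n p, lt m n -> lt n p -> lt m p,
      forall m n, m <> n -> lt m n \/ lt n m,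
      well_founded lt
    & forall m n t, lt m n -> lt (mmul t m) (mmul t n)].

Variable sigma : {lrmorphism P -> P}.

Definition infinite_order : Prop :=
  forall i j, iter i sigma =1 iter j sigma -> i = j.

Definition maps_monomials : Prop := forall m, exists n, sigma (monP m) = monP n.

Definition compatible_order (lt : Mon -> Mon -> Prop) : Prop :=
  forall m n m' n', sigma (monP m) = monP m' -> sigma (monP n) = monP n' ->
    lt m n -> lt m' n'.

Definition admissible_endo : Prop :=
  [/\ injective sigma,
      infinite_order,
      maps_monomials,
      forall i j, i <> j ->
        gcd_one (sigma (monP (varM i))) (sigma (monP (varM j)))
    & exists lt, monomial_order lt /\ compatible_order lt].

Definition Sigma_invariant (I : set P) : Prop := forall f, I f -> I (sigma f).

(* None stands for -oo *)
Notation Nhat := (option nat).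

Definition Nhat_max (a b : Nhat) : Nhat :=
  match a, b with
  | None, _ => b
  | _, None => a
  | Some m, Some n => Some (maxn m n)
  end.

Definition weight_function (w : Mon -> Nhat) : Prop :=
  [/\ w mone = None,
      forall i, exists k, w (varM i) = Some k,
      forall m n, w (mmul m n) = Nhat_max (w m) (w n)
    & forall i m, sigma (monP (varM i)) = monP m ->
        w m = omap succn (w (varM i))].

Variable w : Mon -> Nhat.

Definition spanK (A : set P) : set P :=
  [set f | exists (s : seq P) (c : P -> K),
     (forall g, g \in s -> A g) /\ f = \sum_(g <- s) c g *: g].

Definition weight_component (a : Nhat) : set P :=
  spanK (monP @` [set m | w m = a]).

Definition sum_subspaces (V : Nhat -> set P) : set P :=
  [set f | exists (s : seq Nhat) (g : Nhat -> P),
     (forall a, a \in s -> V a (g a)) /\ f = \sum_(a <- s) g a].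

Definition ideal_component (I : set P) (a : Nhat) : set P :=
  I `&` weight_component a.

Definition w_graded (I : set P) : Prop := I = sum_subspaces (ideal_component I).

Definition graded_invariant_ideals : set (set P) :=
  [set I | [/\ is_ideal I, I <> setT, w_graded I & Sigma_invariant I]].

(* Only the components of weight i : nat contribute; that of weight -oo is 0
   for a proper ideal. *)
Definition skew_analogue (I : set P) : set (skewpoly sigma) :=
  ideal_gen [set F | exists i f,
    ideal_component I (Some i) f /\ F = f *: skews sigma ^+ i].

End Polynomials.

Arguments Sigma_invariant {K} sigma I.
Arguments graded_invariant_ideals {K} sigma w.
Arguments skew_analogue {K} sigma w I.

(* Main.v *)
(* pi sends the generator f s^i of I^S back to f, and the components I_i with
   i : nat span I because a proper ideal meets P_{-oo} = K only in 0; hence I is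
   contained in pi(I^S).  Conversely the skew polynomials with all coefficients
   in I form a two-sided ideal of S, as I is Sigma-invariant; it contains the
   generators of I^S, so pi(I^S) is contained in I.  Thus pi recovers I from
   I^S, and I |-> I^S is injective. *)
Require Import Defs.
From mathcomp Require Import all_boot all_order all_algebra.
From mathcomp Require Import finmap.
From mathcomp Require Import boolp classical_sets functions.
From mathcomp Require Import monalg.
Import GRing.Theory.
Local Open Scope ring_scope.
Local Open Scope classical_set_scope.

Set Implicit Arguments.
Unset Strict Implicit.
Unset Printing Implicit Defensive.

Section Ideals.
Variables (R : nzRingType) (I : set R).
Hypothesis idI : is_ideal I.

Lemma is_ideal_sum (J : Type) (s : seq J) (Q : pred J) (F : J -> R) :
  (forall j, Q j -> I (F j)) -> I (\sum_(j <- s | Q j) F j).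
Proof. by case: idI => I0 ID _ _; apply: big_ind. Qed.

Lemma is_ideal1 : I 1 -> I = setT.
Proof.
case: idI => _ _ IMl _ I1; apply/seteqP; split=> // x _.
by rewrite -[x]mulr1; apply: IMl.
Qed.

Lemma ideal_gen_min (G : set R) : G `<=` I -> ideal_gen G `<=` I.
Proof. by move=> GI x; apply. Qed.

End Ideals.

Section IdealGen.
Variables (R : nzRingType) (G : set R).

Lemma sub_ideal_gen : G `<=` ideal_gen G.
Proof. by move=> x Gx A [_]; apply. Qed.

Lemma ideal_gen_is_ideal : is_ideal (ideal_gen G).
Proof.
split=> [A [[]]//|x y Gx Gy A AG|a x Gx A AG|a x Gx A AG];
  have [[A0 AD AMl AMr] _] := AG.
- by apply: AD; [apply: Gx | apply: Gy].
- by apply: AMl; apply: Gx.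
- by apply: AMr; apply: Gx.
Qed.

End IdealGen.

Section SkewPoly.
Variables (R : nzRingType) (sigma : {rmorphism R -> R}).
Local Notation S := (skewpoly sigma).

(** Additivity of [skewpi] then comes from evaluation of ordinary polynomials, since the twist
    affects only products. *)
Lemma skewpi_horner (F : S) : skewpi sigma F = (F : {poly R}).[1].
Proof. by rewrite horner_coef; apply: eq_bigr => i _; rewrite expr1n mulr1. Qed.

Lemma skewpi0 : skewpi sigma 0 = 0.
Proof. by rewrite skewpi_horner; apply: (@horner0 R). Qed.

Lemma skewpiD (F G : S) : skewpi sigma (F + G) = skewpi sigma F + skewpi sigma G.
Proof. by rewrite !skewpi_horner; apply: (@hornerD R). Qed.

Lemma skewpi_monomial (f : R) i : skewpi sigma (f *: skews sigma ^+ i) = f.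
Proof.
rewrite skewpi_horner skewsX.
change ((f *: 'X^i : {poly R}).[1] = f).
by rewrite hornerZ hornerXn expr1n mulr1.
Qed.

Variable I : set R.
Hypothesis idI : is_ideal I.
Hypothesis sigmaI : forall x, I x -> I (sigma x).

(** Left multiplication applies powers of [sigma] to the coefficients in [I], so this side needs
    invariance; right multiplication leaves them untwisted. *)
Lemma coef_ideal_is_ideal :
  is_ideal [set F : S | forall i, I (F : {poly R})`_i].
Proof.
have [I0 ID IMl IMr] := idI.
have sgI j x : I x -> I (iter j sigma x).
  by move=> Ix; elim: j => //= j; apply: sigmaI.
split=> [i|F G IF IG i|F G IG i|F G IG i] /=.
- by change (I (0 : {poly R})`_i); rewrite coef0.
- by change (I ((F : {poly R}) + G)`_i); rewrite coefD; apply: ID.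
- change (I (skew_mul sigma F G)`_i); rewrite coef_skew_mul.
  by apply: is_ideal_sum => // j _; apply: IMl; apply: sgI.
- change (I (skew_mul sigma G F)`_i); rewrite coef_skew_mul.
  by apply: is_ideal_sum => // j _; apply: IMr.
Qed.

(** As a right multiple of [f], every coefficient lies in an ideal containing [f], with no case
    split on [k]. *)
Lemma coef_skew_monomial (f : R) i k :
  (f *: skews sigma ^+ i : {poly R})`_k = f * (k == i)%:R.
Proof.
rewrite skewsX; change ((f *: 'X^i : {poly R})`_k = f * (k == i)%:R).
by rewrite coefZ coefXn.
Qed.

End SkewPoly.

Section Weights.
Variables (K : fieldType) (sigma : {lrmorphism Pol K -> Pol K}).
Variable w : Mon -> option nat.
Hypothesis wf : weight_function sigma w.
Local Notation P := (Pol K).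

(** A variable dividing [m] would bound its weight below by a natural number. *)
Lemma weight_None (m : Mon) : w m = None -> m = mone.
Proof.
have [_ wX wM _] := wf => wm; apply/eqP/cmP => i; rewrite cm1.
case: (posnP (m i)) => // mi_gt0.
have em : m = mmul (varM i) (divcm m (varM i)).
  apply/eqP/cmP => j; rewrite cmM divcmE /varM cmU.
  by case: eqP => [<-|_]; rewrite ?subnKC ?subn0.
have [k wXi] := wX i.
by move: wm; rewrite em wM wXi; case: (w _).
Qed.

Variable I : set P.
Hypotheses (idI : is_ideal I) (I_proper : I <> setT).

(** Such an [f] is a scalar; a nonzero one would be a unit in [I]. *)
Lemma proper_ideal_component_None f : ideal_component w I None f -> f = 0.
Proof.
move=> [If [s [c [sm ef]]]]; have [_ _ IMl _] := idI.
have {}ef : f = (\sum_(g <- s) c g) *: 1.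
  rewrite scaler_suml ef; apply: eq_big_seq => g /sm [m /= wm <-].
  by rewrite (weight_None wm); congr (_ *: _).
apply/eqP/negPn/negP => f0; apply: I_proper; apply: is_ideal1 => //.
set k := \sum_(g <- s) c g in ef.
have k0 : k != 0 by apply: contraNneq f0; rewrite ef => ->; rewrite scale0r.
rewrite -[1](scalerK k0) -ef.
by rewrite -[f]mul1r scalerAl; apply: IMl.
Qed.

Hypotheses (grI : w_graded w I) (invI : Sigma_invariant sigma I).

Lemma skewpi_skew_analogue : skewpi sigma @` skew_analogue sigma w I = I.
Proof.
have [I0 ID IMl IMr] := idI; apply/seteqP; split.
  move=> _ [F IF <-]; apply: is_ideal_sum => // i _.
  (* By minimality, [F] has all its coefficients in [I] once the generators do. *)
  apply: (ideal_gen_min (coef_ideal_is_ideal idI invI) _ IF).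
  move=> _ [j [f [[If _] ->]]] k /=.
  by rewrite coef_skew_monomial; apply: IMr.
rewrite [X in X `<=` _]grI => _ [s [g [sg ->]]].
have [G0 GD _ _] := ideal_gen_is_ideal [set F : skewpoly sigma | exists i f,
    ideal_component w I (Some i) f /\ F = f *: skews sigma ^+ i].
(* The image of [skewpi] is closed under sums, so one homogeneous component at a time suffices. *)
rewrite big_seq; apply: big_ind => [|_ _ [F SF <-] [G SG <-]|a /sg].
- by exists 0; rewrite ?skewpi0.
- by exists (F + G); rewrite ?skewpiD //; apply: GD.
case: a => [i|] Ia; last first.
  by exists 0; rewrite ?skewpi0 ?(proper_ideal_component_None Ia).
(* The exponent of [s] must match the weight [i] for this to be a generator. *)
exists (g (Some i) *: skews sigma ^+ i); last by rewrite skewpi_monomial.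
by apply: sub_ideal_gen; exists i, (g (Some i)).
Qed.

End Weights.

Theorem proposition5p12 (K : fieldType) (sigma : {lrmorphism Pol K -> Pol K})
    (w : Mon -> option nat) :
  admissible_endo sigma ->
  weight_function sigma w ->
  (forall I : set (Pol K),
     is_ideal I -> I <> setT -> w_graded w I -> Sigma_invariant sigma I ->
     skewpi sigma @` skew_analogue sigma w I = I)
  /\ set_bij (graded_invariant_ideals sigma w)
       (skew_analogue sigma w @` graded_invariant_ideals sigma w)
       (skew_analogue sigma w).
Proof.
move=> _ wf; have piK := @skewpi_skew_analogue K sigma w wf.
split=> //; split=> [I PI|I J /set_mem[idI pI gI sI] /set_mem[idJ pJ gJ sJ] eIJ|//].
- by exists I.
(* Injectivity: [skewpi] recovers both ideals from their common skew analogue. *)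
- by rewrite -(piK I) // eIJ piK.
Qed.
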